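(* Let $K$ and $Q$ be groups, let $\theta:Q\to\mathrm{Out}(K)$ be an outer action, and let $(G,i,\pi)$ be an extension of $K$ by $Q$ with outer action $\theta$. Then the isomorphism of groups $$-\star: Z^1(Q,Z(K))\xrightarrow{\ \simeq\ }\mathrm{Aut}(KGQ),\qquad \lambda\mapsto\bigl(g\mapsto\lambda(\pi(g))\cdot g\bigr),$$ induces an isomorphism of groups $$-\star: H^1(Q,Z(K))\xrightarrow{\ \simeq\ }\mathrm{Out}(KGQ;K)\ \subseteq\ \mathrm{Out}(G;K).$$
   Context: Conventions. $Z(K)$ is the centre of $K$. For a group $H$ and an $H$-module $A$ (written multiplicatively), cochains are normalized (trivial value whenever an argument is the identity); $Z^1(H,A)$ is the group of maps $\lambda$ with $\lambda(h_1h_2)=\lambda(h_1)\cdot{}^{h_1}\lambda(h_2)$, $B^1(H,A)$ is the group of maps $\partial a(h)=a^{-1}\cdot{}^{h}a$ with $a\in A$, and $H^1=Z^1/B^1$. An extension of $K$ by $Q$ is a triple $(G,i,\pi)$ with $i:K\to G$ an injective homomorphism, $\pi:G\to Q$ a surjective homomorphism, $i(K)=\mathrm{Ker}(\pi)$; $K$ is identified with $i(K)$. Conjugation of $G$ on $K$ induces a homomorphism $Q\to\mathrm{Out}(K)=\mathrm{Aut}(K)/\mathrm{Inn}(K)$, the outer action of the extension. $Q$ acts on $Z(K)$ via $\theta$. $\mathrm{Aut}(KGQ):=\{\xi\in\mathrm{Aut}(G):\xi\circ i=i,\ \pi\circ\xi=\pi\}$. $\mathrm{Aut}_K(G)$ is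 the group of automorphisms $\eta$ of $G$ with $\eta(K)=K$; $\complement_G(K)$ is its normal subgroup consisting of the inner automorphisms $x\mapsto kxk^{-1}$, $k\in K$; $\mathrm{Out}(G;K):=\mathrm{Aut}_K(G)/\complement_G(K)$; $\mathrm{Out}(KGQ;K)$ is the image of $\mathrm{Aut}(KGQ)$ in $\mathrm{Out}(G;K)$. *)

(* Defs.v *)
From HB Require Import structures.
From mathcomp Require Import all_boot.
From mathcomp Require Import boolp classical_sets.

Set Implicit Arguments.
Unset Strict Implicit.
Unset Printing Implicit Defensive.

Local Open Scope group_scope.

(* Groups are arbitrary, possibly infinite: [groupType] of [mathcomp.boot.monoid].
   The choice structure that [groupType] carries is no restriction in the
   classical setting of [boolp].  A homomorphism of groups is a
   [{multiplicative G -> H}].  Conjugation by g is on the left, g x g^-1, unlike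
   the right conjugation [x ^ g] of MathComp. *)

Definition surjective (aT rT : Type) (f : aT -> rT) :=
  forall y, exists x, f x = y.

Record subgroup (G : groupType) := Subgroup {
  subgroup_pred :> {pred G};
  subgroup_closed : group_closed subgroup_pred
}.

Record normal_subgroup (G : groupType) := NormalSubgroup {
  normal_subgroup_sub :> subgroup G;
  normal_subgroupJ : forall g x : G,
    x \in normal_subgroup_sub -> g * x * g^-1 \in normal_subgroup_sub
}.

Section SubgroupTheory.
Variables (G : groupType) (S : subgroup G).

Lemma subgroup1 : 1 \in S.
Proof. by have [] := subgroup_closed S. Qed.

Lemma subgroupM : mulg_closed S.
Proof. exact/group_closedM/subgroup_closed. Qed.

Lemma subgroupV x : (x^-1 \in S) = (x \in S).
Proof.
have SV := group_closedV (subgroup_closed S).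
by apply/idP/idP => /SV; rewrite ?invgK.
Qed.

Fact group_closedMV (P : {pred G}) :
  1 \in P -> mulg_closed P -> invg_closed P -> group_closed P.
Proof. by move=> P1 PM PV; split=> // x y xP yP; apply/PM/PV. Qed.

End SubgroupTheory.

Record sgroup (G : groupType) (S : subgroup G) :=
  SGroup { sgval :> G; sgvalP : sgval \in S }.

Section SGroup.
Variables (G : groupType) (S : subgroup G).

HB.instance Definition _ := [isSub for @sgval G S].
HB.instance Definition _ := [Choice of sgroup S by <:].
HB.instance Definition _ :=
  SubChoice_isSubGroup.Build G (fun x => x \in S) (sgroup S) (subgroup_closed S).

End SGroup.

Section Quotient.
Variables (G : groupType) (N : normal_subgroup G).

Definition coset_rel (x y : G) : bool := x^-1 * y \in N.

Fact coset_rel_refl : reflexive coset_rel.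
Proof. by move=> x; rewrite /coset_rel mulVg subgroup1. Qed.

Fact coset_rel_sym : symmetric coset_rel.
Proof. by move=> x y; rewrite /coset_rel -subgroupV invgM invgK. Qed.

Fact coset_rel_trans : transitive coset_rel.
Proof.
move=> y x z xy yz; rewrite /coset_rel -(mulVKg y z) mulgA.
exact: subgroupM xy yz.
Qed.

Canonical coset_equiv :=
  EquivRel coset_rel coset_rel_refl coset_rel_sym coset_rel_trans.

Definition quot := {eq_quot coset_equiv}%qT.

HB.instance Definition _ := Choice.on quot.

Definition coset (x : G) : quot := (\pi_({eq_quot coset_equiv}) x)%qT.

Lemma coset_eq (x y : G) : reflect (coset x = coset y) (x^-1 * y \in N).
Proof. exact: (@eqmodP _ coset_equiv x y). Qed.

Definition coset_repr (c : quot) : G := repr (c : {eq_quot coset_equiv}%qT).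

Lemma coset_reprK (c : quot) : coset (coset_repr c) = c.
Proof. exact: reprK. Qed.

Lemma coset_surj : surjective coset.
Proof. by move=> c; exists (coset_repr c); apply: coset_reprK. Qed.

Definition quot_one : quot := coset 1.
Definition quot_mul (c d : quot) : quot := coset (coset_repr c * coset_repr d).
Definition quot_inv (c : quot) : quot := coset (coset_repr c)^-1.

Fact quot_mulE x y : quot_mul (coset x) (coset y) = coset (x * y).
Proof.
apply/coset_eq.
have /coset_eq xN := coset_reprK (coset x).
have /coset_eq yN := coset_reprK (coset y).
move: (coset_repr (coset x)) (coset_repr (coset y)) xN yN => a b aN bN.
rewrite invgM !mulgA.
have -> : b^-1 * a^-1 * x * y = (b^-1 * y) * (y^-1 * (a^-1 * x) * y^-1^-1).
  by rewrite invgK !mulgA mulgK.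
by rewrite subgroupM // normal_subgroupJ.
Qed.

Fact quot_invE x : quot_inv (coset x) = coset x^-1.
Proof.
apply/coset_eq; have /coset_eq := coset_reprK (coset x).
move: (coset_repr (coset x)) => a aN.
rewrite invgK -subgroupV invgM invgK.
have -> : x * a^-1 = a * (a^-1 * x) * a^-1 by rewrite !mulgA mulgV mul1g.
exact: normal_subgroupJ.
Qed.

Fact quot_mulA : associative quot_mul.
Proof.
move=> c d e; have [x <-] := coset_surj c; have [y <-] := coset_surj d.
by have [z <-] := coset_surj e; rewrite !quot_mulE mulgA.
Qed.

Fact quot_mul1 : left_id quot_one quot_mul.
Proof. by move=> c; have [x <-] := coset_surj c; rewrite quot_mulE mul1g. Qed.

Fact quot_mulr1 : right_id quot_one quot_mul.
Proof. by move=> c; have [x <-] := coset_surj c; rewrite quot_mulE mulg1. Qed.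

Fact quot_mulV : left_inverse quot_one quot_inv quot_mul.
Proof.
by move=> c; have [x <-] := coset_surj c; rewrite quot_invE quot_mulE mulVg.
Qed.

Fact quot_mulrV : right_inverse quot_one quot_inv quot_mul.
Proof.
by move=> c; have [x <-] := coset_surj c; rewrite quot_invE quot_mulE mulgV.
Qed.

HB.instance Definition _ := isGroup.Build quot
  quot_mulA quot_mul1 quot_mulr1 quot_mulV quot_mulrV.

Fact coset_morph : {morph coset : x y / x * y}.
Proof. by move=> x y; rewrite -quot_mulE. Qed.

HB.instance Definition _ := isMultiplicative.Build G quot coset coset_morph.

End Quotient.

Record aut (G : groupType) := Aut {
  aut_fun :> G -> G;
  aut_subproof : `[< bijective aut_fun /\ {morph aut_fun : x y / x * y} >]
}.

Section Aut.
Variable G : groupType.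

HB.instance Definition _ := [isSub for @aut_fun G].
HB.instance Definition _ := [Choice of aut G by <:].

Lemma autP (f : aut G) : bijective f /\ {morph f : x y / x * y}.
Proof. exact/asboolP/(aut_subproof f). Qed.

Lemma aut_bij (f : aut G) : bijective f.
Proof. by have [] := autP f. Qed.

Lemma autM (f : aut G) : {morph f : x y / x * y}.
Proof. by have [] := autP f. Qed.

HB.instance Definition _ (f : aut G) :=
  isMultiplicative.Build G G (aut_fun f) (autM f).

Lemma aut_eq (f g : aut G) : f =1 g -> f = g.
Proof. by move=> fg; apply/val_inj/funext. Qed.

Definition mk_aut (f : G -> G) (fbij : bijective f)
  (fM : {morph f : x y / x * y}) : aut G := Aut (asboolT (conj fbij fM)).

Fact aut_inv_ex (f : aut G) : exists h : G -> G, cancel f h /\ cancel h f.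
Proof. by have [h fK hK] := aut_bij f; exists h. Qed.

Definition aut_inv_fun (f : aut G) : G -> G := projT1 (cid (aut_inv_ex f)).

Fact aut_funK (f : aut G) : cancel f (aut_inv_fun f).
Proof. by rewrite /aut_inv_fun; case: cid => h []. Qed.

Fact aut_funKV (f : aut G) : cancel (aut_inv_fun f) f.
Proof. by rewrite /aut_inv_fun; case: cid => h []. Qed.

Definition aut_one : aut G := mk_aut (Bijective (fun=> erefl) (fun=> erefl))
  (fun x y => erefl : idfun (x * y) = idfun x * idfun y).

Fact aut_mul_morph (f g : aut G) : {morph f \o g : x y / x * y}.
Proof. by move=> x y; rewrite /= !autM. Qed.

Definition aut_mul (f g : aut G) : aut G :=
  mk_aut (bij_comp (aut_bij f) (aut_bij g)) (aut_mul_morph f g).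

Fact aut_inv_morph (f : aut G) : {morph aut_inv_fun f : x y / x * y}.
Proof. exact: can2_gmulfM (aut_funK f) (aut_funKV f). Qed.

Definition aut_inv (f : aut G) : aut G :=
  mk_aut (Bijective (aut_funKV f) (aut_funK f)) (aut_inv_morph f).

Fact aut_mulA : associative aut_mul.
Proof. by move=> f g h; apply: aut_eq. Qed.

Fact aut_mul1 : left_id aut_one aut_mul.
Proof. by move=> f; apply: aut_eq. Qed.

Fact aut_mulr1 : right_id aut_one aut_mul.
Proof. by move=> f; apply: aut_eq. Qed.

Fact aut_mulV : left_inverse aut_one aut_inv aut_mul.
Proof. by move=> f; apply: aut_eq => x /=; rewrite aut_funK. Qed.

Fact aut_mulrV : right_inverse aut_one aut_inv aut_mul.
Proof. by move=> f; apply: aut_eq => x /=; rewrite aut_funKV. Qed.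

HB.instance Definition _ := isGroup.Build (aut G)
  aut_mulA aut_mul1 aut_mulr1 aut_mulV aut_mulrV.

Lemma aut1E x : (1 : aut G) x = x. Proof. by []. Qed.
Lemma autME (f g : aut G) x : (f * g) x = f (g x). Proof. by []. Qed.
Lemma autKV (f : aut G) : cancel f^-1 f. Proof. exact: aut_funKV. Qed.
Lemma autVK (f : aut G) : cancel f f^-1. Proof. exact: aut_funK. Qed.
Lemma aut_1 (f : aut G) : f 1 = 1.
Proof. by apply: (@mulgI _ (f 1)); rewrite -autM !mulg1. Qed.
Lemma aut_V (f : aut G) x : f x^-1 = (f x)^-1.
Proof. by apply: (@mulgI _ (f x)); rewrite -autM !mulgV aut_1. Qed.

Fact conj_bij (g : G) : bijective (fun x => g * x * g^-1).
Proof.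
exists (fun x => g^-1 * x * g) => x; first by rewrite !mulgA mulVg mul1g mulgVK.
by rewrite !mulgA mulgV mul1g mulgK.
Qed.

Fact conj_morph (g : G) : {morph (fun x => g * x * g^-1) : x y / x * y}.
Proof. by move=> x y; rewrite !mulgA mulgVK. Qed.

Definition conj_aut (g : G) : aut G := mk_aut (conj_bij g) (@conj_morph g).

Lemma conj_autE g x : conj_aut g x = g * x * g^-1. Proof. by []. Qed.

Fact conj_aut_morph : {morph conj_aut : g h / g * h}.
Proof. by move=> g h; apply: aut_eq => x; rewrite /= invgM !mulgA. Qed.

HB.instance Definition _ :=
  isMultiplicative.Build G (aut G) conj_aut conj_aut_morph.

Lemma conj_autJ (f : aut G) g : f * conj_aut g * f^-1 = conj_aut (f g).
Proof. by apply: aut_eq => x; rewrite !autME !conj_autE !autM aut_V autKV. Qed.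

Lemma conj_aut1 : conj_aut 1 = 1.
Proof. by apply: aut_eq => x; rewrite conj_autE invg1 mulg1 mul1g. Qed.

Lemma conj_autV g : conj_aut g^-1 = (conj_aut g)^-1.
Proof.
by apply: (@mulgI _ (conj_aut g)); rewrite -conj_aut_morph !mulgV conj_aut1.
Qed.

Definition inner_pred : {pred aut G} := fun f => `[< exists g, f = conj_aut g >].

Lemma innerP f : reflect (exists g, f = conj_aut g) (f \in inner_pred).
Proof. exact: asboolP. Qed.

Fact inner1 : 1 \in inner_pred.
Proof. by apply/innerP; exists 1; rewrite conj_aut1. Qed.

Fact innerM : mulg_closed inner_pred.
Proof.
move=> _ _ /innerP[g ->] /innerP[h ->].
by apply/innerP; exists (g * h); rewrite conj_aut_morph.
Qed.

Fact innerV : invg_closed inner_pred.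
Proof. by move=> _ /innerP[g ->]; apply/innerP; exists g^-1; rewrite conj_autV. Qed.

Fact innerJ (f x : aut G) : x \in inner_pred -> f * x * f^-1 \in inner_pred.
Proof. by move=> /innerP[g ->]; apply/innerP; exists (f g); rewrite conj_autJ. Qed.

Definition inner : normal_subgroup (aut G) :=
  NormalSubgroup (normal_subgroup_sub :=
    Subgroup (group_closedMV inner1 innerM innerV)) innerJ.

Definition out := quot inner.

HB.instance Definition _ := Group.on out.

Definition center_pred : {pred G} := fun z => `[< forall x, commute z x >].

Lemma centerP z : reflect (forall x, commute z x) (z \in center_pred).
Proof. exact: asboolP. Qed.

Fact center1 : 1 \in center_pred.
Proof. by apply/centerP => x; apply/commute_sym/commute1. Qed.

Fact centerM : mulg_closed center_pred.
Proof.
move=> y z /centerP yC /centerP zC; apply/centerP => x.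
by apply/commute_sym/commuteM; apply: commute_sym.
Qed.

Fact centerV : invg_closed center_pred.
Proof.
move=> z /centerP zC; apply/centerP => x.
exact/commute_sym/commuteV/commute_sym.
Qed.

Definition center : subgroup G :=
  Subgroup (group_closedMV center1 centerM centerV).

Lemma aut_center (f : aut G) z : z \in center -> f z \in center.
Proof.
move=> /centerP zC; apply/centerP => x.
by rewrite -(autKV f x) /commute -!autM zC.
Qed.

End Aut.

Record hmodule (H : groupType) := HModule {
  hmcar :> groupType;
  hmact : H -> hmcar -> hmcar;
  hmC : forall a b : hmcar, a * b = b * a;
  hmact1 : forall a, hmact 1 a = a;
  hmactM : forall g h a, hmact (g * h) a = hmact g (hmact h a);
  hmactD : forall h, {morph hmact h : a b / a * b}
}.

(* cochains are normalized, hence the (here redundant) condition at 1 *)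
Definition is_cocycle (H : groupType) (A : hmodule H) (l : H -> A) :=
  l 1 = 1 /\ forall h1 h2, l (h1 * h2) = l h1 * hmact h1 (l h2).

Record Z1 (H : groupType) (A : hmodule H) := Cocycle {
  cocycle_fun :> H -> A;
  cocycle_subproof : `[< is_cocycle cocycle_fun >]
}.

Section Cohomology.
Variables (H : groupType) (A : hmodule H).

HB.instance Definition _ := [isSub for @cocycle_fun H A].
HB.instance Definition _ := [Choice of Z1 A by <:].

Lemma cocycleP (l : Z1 A) : is_cocycle l.
Proof. exact/asboolP/(cocycle_subproof l). Qed.

Lemma cocycle_eq (l m : Z1 A) : l =1 m -> l = m.
Proof. by move=> lm; apply/val_inj/funext. Qed.

Lemma hmact_1 h : hmact h (1 : A) = 1.
Proof. by apply: (@mulgI _ (hmact h 1)); rewrite -hmactD !mulg1. Qed.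

Lemma hmact_V h (a : A) : hmact h a^-1 = (hmact h a)^-1.
Proof. by apply: (@mulgI _ (hmact h a)); rewrite -hmactD !mulgV hmact_1. Qed.

Fact Z1_one_subproof : is_cocycle (fun=> 1 : A).
Proof. by split=> // h1 h2; rewrite hmact_1 mulg1. Qed.

Fact Z1_mul_subproof (l m : Z1 A) : is_cocycle (fun h => l h * m h).
Proof.
have [l1 lM] := cocycleP l; have [m1 mM] := cocycleP m; split.
  by rewrite l1 m1 mulg1.
move=> h1 h2; rewrite lM mM hmactD !mulgA; congr (_ * _).
by rewrite -!mulgA; congr (_ * _); rewrite hmC.
Qed.

Fact Z1_inv_subproof (l : Z1 A) : is_cocycle (fun h => (l h)^-1).
Proof.
have [l1 lM] := cocycleP l; split; first by rewrite l1 invg1.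
by move=> h1 h2; rewrite lM invgM hmact_V hmC.
Qed.

Definition Z1_one : Z1 A := Cocycle (asboolT Z1_one_subproof).
Definition Z1_mul (l m : Z1 A) : Z1 A := Cocycle (asboolT (Z1_mul_subproof l m)).
Definition Z1_inv (l : Z1 A) : Z1 A := Cocycle (asboolT (Z1_inv_subproof l)).

Fact Z1_mulA : associative Z1_mul.
Proof. by move=> l m n; apply: cocycle_eq => h /=; rewrite mulgA. Qed.

Fact Z1_mul1 : left_id Z1_one Z1_mul.
Proof. by move=> l; apply: cocycle_eq => h /=; rewrite mul1g. Qed.

Fact Z1_mulr1 : right_id Z1_one Z1_mul.
Proof. by move=> l; apply: cocycle_eq => h /=; rewrite mulg1. Qed.

Fact Z1_mulV : left_inverse Z1_one Z1_inv Z1_mul.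
Proof. by move=> l; apply: cocycle_eq => h /=; rewrite mulVg. Qed.

Fact Z1_mulrV : right_inverse Z1_one Z1_inv Z1_mul.
Proof. by move=> l; apply: cocycle_eq => h /=; rewrite mulgV. Qed.

HB.instance Definition _ := isGroup.Build (Z1 A)
  Z1_mulA Z1_mul1 Z1_mulr1 Z1_mulV Z1_mulrV.

Lemma Z1_oneE h : (1 : Z1 A) h = 1. Proof. by []. Qed.
Lemma Z1_mulE (l m : Z1 A) h : (l * m) h = l h * m h. Proof. by []. Qed.
Lemma Z1_invE (l : Z1 A) h : l^-1 h = (l h)^-1. Proof. by []. Qed.

Definition B1_pred : {pred Z1 A} :=
  fun l => `[< exists a : A, forall h, l h = a^-1 * hmact h a >].

Lemma B1P (l : Z1 A) :
  reflect (exists a : A, forall h, l h = a^-1 * hmact h a) (l \in B1_pred).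
Proof. exact: asboolP. Qed.

Fact B1_1 : 1 \in B1_pred.
Proof. by apply/B1P; exists 1 => h; rewrite hmact_1 mulg1 invg1. Qed.

Fact B1_M : mulg_closed B1_pred.
Proof.
move=> l m /B1P[a la] /B1P[b mb]; apply/B1P; exists (a * b) => h.
rewrite Z1_mulE la mb hmactD invgM (hmC b^-1 a^-1) -!mulgA; congr (_ * _).
by rewrite !mulgA (hmC (hmact h a)).
Qed.

Fact B1_V : invg_closed B1_pred.
Proof.
move=> l /B1P[a la]; apply/B1P; exists a^-1 => h.
by rewrite Z1_invE la hmact_V invgM hmC.
Qed.

Fact B1_J (l m : Z1 A) : m \in B1_pred -> l * m * l^-1 \in B1_pred.
Proof.
move=> mB; suff -> : l * m * l^-1 = m by [].
by apply: cocycle_eq => h; rewrite !Z1_mulE Z1_invE (hmC (l h)) mulgK.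
Qed.

Definition B1 : normal_subgroup (Z1 A) :=
  NormalSubgroup (normal_subgroup_sub :=
    Subgroup (group_closedMV B1_1 B1_M B1_V)) B1_J.

Definition H1 := quot B1.

HB.instance Definition _ := Group.on H1.

End Cohomology.

Section CenterModule.
Variables (K Q : groupType) (theta : {multiplicative Q -> out K}).

(* q acts on Z(K) through any automorphism of K in the class theta(q); all of
   them agree on Z(K), as [center_actE] shows. *)
Definition center_act (q : Q) (z : sgroup (center K)) : sgroup (center K) :=
  SGroup (aut_center (coset_repr (theta q)) (sgvalP z)).

Lemma center_actE q (f : aut K) : coset (inner K) f = theta q ->
  forall z, sgval (center_act q z) = f (sgval z).
Proof.
move=> fq [z /= zC]; set r := coset_repr _.
have /coset_eq/innerP[k rk] : coset (inner K) r = coset (inner K) f.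
  by rewrite fq coset_reprK.
have {rk} -> : f = r * conj_aut k by rewrite -rk mulVKg.
rewrite autME conj_autE; congr (r _).
by rewrite -(centerP _ zC k) mulgK.
Qed.

Fact center_mulC (y z : sgroup (center K)) : y * z = z * y.
Proof. by apply/val_inj; rewrite !valM; apply: (centerP _ (sgvalP y)). Qed.

Fact theta1 : theta 1 = 1.
Proof. by apply: (@mulgI _ (theta 1)); rewrite -gmulfM !mulg1. Qed.

Fact center_act1 z : center_act 1 z = z.
Proof.
by apply/val_inj; apply: (@center_actE 1 1); rewrite theta1.
Qed.

Fact center_actM p q z : center_act (p * q) z = center_act p (center_act q z).
Proof.
apply/val_inj.
apply: (@center_actE _ (coset_repr (theta p) * coset_repr (theta q))).
by rewrite !gmulfM; congr (_ * _); apply: coset_reprK.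
Qed.

Fact center_actD q : {morph center_act q : y z / y * z}.
Proof. by move=> y z; apply/val_inj; rewrite /= autM. Qed.

Definition center_module : hmodule Q :=
  HModule center_mulC center_act1 center_actM center_actD.

End CenterModule.

Record extension (K Q : groupType) := Extension {
  ext_group :> groupType;
  ext_i : {multiplicative K -> ext_group};
  ext_pi : {multiplicative ext_group -> Q};
  ext_i_inj : injective ext_i;
  ext_pi_surj : surjective ext_pi;
  ext_exact : (range ext_i = [set g | ext_pi g = 1])%classic
}.

Section Extension.
Variables (K Q : groupType) (G : extension K Q).
Local Notation i := (ext_i G).
Local Notation pi := (ext_pi G).

Lemma ext_kerP (g : G) : (pi g = 1) <-> exists k, i k = g.
Proof.
have /seteqP[ik ki] := ext_exact G; split=> [/ki[k _ <-]|[k <-]].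
  by exists k.
by apply: ik; exists k.
Qed.

Lemma ext_i1 : i 1 = 1.
Proof. by apply: (@mulgI _ (i 1)); rewrite -gmulfM !mulg1. Qed.

Lemma ext_iV k : i k^-1 = (i k)^-1.
Proof. by apply: (@mulgI _ (i k)); rewrite -gmulfM !mulgV ext_i1. Qed.

Lemma ext_pi1 : pi 1 = 1.
Proof. by apply: (@mulgI _ (pi 1)); rewrite -gmulfM !mulg1. Qed.

Lemma ext_piV g : pi g^-1 = (pi g)^-1.
Proof. by apply: (@mulgI _ (pi g)); rewrite -gmulfM !mulgV ext_pi1. Qed.

Fact ext_normal (g : G) (k : K) : exists k', i k' = g * i k * g^-1.
Proof.
apply/ext_kerP; have /ext_kerP pik : exists k', i k' = i k by exists k.
by rewrite !gmulfM pik mulg1 ext_piV mulgV.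
Qed.

Definition restr_conj_fun (g : G) (k : K) : K := projT1 (cid (ext_normal g k)).

Fact restr_conj_funE g k : i (restr_conj_fun g k) = g * i k * g^-1.
Proof. by rewrite /restr_conj_fun; case: cid. Qed.

Fact restr_conj_bij g : bijective (restr_conj_fun g).
Proof.
exists (restr_conj_fun g^-1) => k; apply: (@ext_i_inj _ _ G);
  rewrite !restr_conj_funE invgK !mulgA.
  by rewrite mulVg mul1g mulgVK.
by rewrite mulgV mul1g mulgK.
Qed.

Fact restr_conj_morph g : {morph restr_conj_fun g : x y / x * y}.
Proof.
move=> x y; apply: (@ext_i_inj _ _ G).
by rewrite gmulfM !restr_conj_funE gmulfM !mulgA mulgVK.
Qed.

(* conjugation by g on K, where K is identified with its image in G *)
Definition restr_conj (g : G) : aut K :=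
  mk_aut (restr_conj_bij g) (@restr_conj_morph g).

Lemma restr_conjE g k : i (restr_conj g k) = g * i k * g^-1.
Proof. exact: restr_conj_funE. Qed.

Definition ext_lift (q : Q) : G := projT1 (cid (ext_pi_surj G q)).

Lemma ext_liftK q : pi (ext_lift q) = q.
Proof. by rewrite /ext_lift; case: cid. Qed.

Definition outer_action (q : Q) : out K :=
  coset (inner K) (restr_conj (ext_lift q)).

Lemma restr_conjM g h : restr_conj (g * h) = restr_conj g * restr_conj h.
Proof.
apply: aut_eq => k; apply: (@ext_i_inj _ _ G).
by rewrite autME !restr_conjE invgM !mulgA.
Qed.

Lemma restr_conj_i k : restr_conj (i k) = conj_aut k.
Proof.
apply: aut_eq => x; apply: (@ext_i_inj _ _ G).
by rewrite restr_conjE conj_autE !gmulfM ext_iV.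
Qed.

(* the choice of the lift of q does not matter *)
Lemma outer_actionE g : outer_action (pi g) = coset (inner K) (restr_conj g).
Proof.
apply/coset_eq/innerP.
have /ext_kerP[k ik] : pi ((ext_lift (pi g))^-1 * g) = 1.
  by rewrite gmulfM ext_piV ext_liftK mulVg.
exists k; rewrite -restr_conj_i ik.
by apply: (@mulgI _ (restr_conj (ext_lift (pi g)))); rewrite mulVKg -restr_conjM mulVKg.
Qed.

Fact outer_action_morph : {morph outer_action : p q / p * q}.
Proof.
move=> p q; rewrite -{1}(ext_liftK p) -{1}(ext_liftK q) -gmulfM outer_actionE.
by rewrite restr_conjM gmulfM.
Qed.

HB.instance Definition _ :=
  isMultiplicative.Build Q (out K) outer_action outer_action_morph.

Definition autKGQ_pred : {pred aut G} := fun xi =>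
  `[< xi \o i =1 i /\ pi \o xi =1 pi >].

Lemma autKGQ_predP (xi : aut G) :
  reflect (xi \o i =1 i /\ pi \o xi =1 pi) (xi \in autKGQ_pred).
Proof. exact: asboolP. Qed.

Fact autKGQ_1 : 1 \in autKGQ_pred.
Proof. exact/autKGQ_predP. Qed.

Fact autKGQ_M : mulg_closed autKGQ_pred.
Proof.
move=> x y /autKGQ_predP[xi xpi] /autKGQ_predP[yi ypi]; apply/autKGQ_predP.
split=> [k|g]; rewrite /= ?autME.
  by have /= -> := yi k; apply: xi.
by have /= -> := xpi (y g); apply: ypi.
Qed.

Fact autKGQ_V : invg_closed autKGQ_pred.
Proof.
move=> x /autKGQ_predP[xi xpi]; apply/autKGQ_predP.
split=> [k|g].
  by have xk : x (i k) = i k := xi k; apply: (canLR (autVK x)).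
by have /= <- := xpi (x^-1 g); rewrite autKV.
Qed.

Definition autKGQ_subgroup : subgroup (aut G) :=
  Subgroup (group_closedMV autKGQ_1 autKGQ_M autKGQ_V).

Definition autKGQ := sgroup autKGQ_subgroup.

HB.instance Definition _ := Group.on autKGQ.

Definition autK_pred : {pred aut G} := fun eta =>
  `[< (eta @` range i = range i)%classic >].

Lemma autK_predP (eta : aut G) :
  reflect (eta @` range i = range i)%classic (eta \in autK_pred).
Proof. exact: asboolP. Qed.

Fact autK_1 : 1 \in autK_pred.
Proof. by apply/autK_predP; apply: image_id. Qed.

Fact autK_M : mulg_closed autK_pred.
Proof.
move=> x y /autK_predP xK /autK_predP yK; apply/autK_predP.
by rewrite -[in RHS]xK -[in RHS]yK -image_comp.
Qed.

Fact autK_V : invg_closed autK_pred.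
Proof.
move=> x /autK_predP xK; apply/autK_predP.
rewrite -[in LHS]xK [LHS]image_comp -[RHS]image_id.
by congr image; apply/funext => g; apply: autVK.
Qed.

Definition autK_subgroup : subgroup (aut G) :=
  Subgroup (group_closedMV autK_1 autK_M autK_V).

Definition autK := sgroup autK_subgroup.

HB.instance Definition _ := Group.on autK.

(* [innerK], [outGK] and [outKGQ] below are respectively the subgroup of
   Aut_K(G) of conjugations by elements of K, Out(G;K) and Out(KGQ;K). *)
Definition innerK_pred : {pred autK} := fun eta =>
  `[< exists k : K, sgval eta = conj_aut (i k) >].

Lemma innerKP (eta : autK) :
  reflect (exists k : K, sgval eta = conj_aut (i k)) (eta \in innerK_pred).
Proof. exact: asboolP. Qed.

Fact innerK_1 : 1 \in innerK_pred.
Proof. by apply/innerKP; exists 1; rewrite ext_i1 conj_aut1. Qed.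

Fact innerK_M : mulg_closed innerK_pred.
Proof.
move=> x y /innerKP[k xk] /innerKP[l yl]; apply/innerKP; exists (k * l).
by rewrite valM /= xk yl gmulfM conj_aut_morph.
Qed.

Fact innerK_V : invg_closed innerK_pred.
Proof.
move=> x /innerKP[k xk]; apply/innerKP; exists k^-1.
by rewrite ext_iV conj_autV -xk.
Qed.

Fact innerK_J (f x : autK) : x \in innerK_pred -> f * x * f^-1 \in innerK_pred.
Proof.
move=> /innerKP[k xk]; apply/innerKP.
have /autK_predP fK := sgvalP f.
have [l _ il] : range i (sgval f (i k)).
  by rewrite -fK; exists (i k) => //; exists k.
exists l; rewrite il -conj_autJ -xk.
by rewrite !valM.
Qed.

Definition innerK : normal_subgroup autK :=
  NormalSubgroup (normal_subgroup_sub :=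
    Subgroup (group_closedMV innerK_1 innerK_M innerK_V)) innerK_J.

Definition outGK := quot innerK.

HB.instance Definition _ := Group.on outGK.

Fact autKGQ_sub (xi : aut G) :
  xi \in autKGQ_subgroup -> xi \in autK_subgroup.
Proof.
move=> /autKGQ_predP[xii _]; apply/autK_predP.
by rewrite [LHS]image_comp (funext xii).
Qed.

Definition autKGQ_incl (xi : autKGQ) : autK :=
  SGroup (S := autK_subgroup) (autKGQ_sub (sgvalP xi)).

Definition autKGQ_class (xi : autKGQ) : outGK :=
  coset innerK (autKGQ_incl xi).

Fact autKGQ_class_morph : {morph autKGQ_class : x y / x * y}.
Proof.
by move=> x y; rewrite /autKGQ_class -gmulfM; congr coset; apply/val_inj.
Qed.

HB.instance Definition _ :=
  isMultiplicative.Build autKGQ outGK autKGQ_class autKGQ_class_morph.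

Definition outKGQ_pred : {pred outGK} := fun c =>
  `[< range autKGQ_class c >].

Lemma outKGQ_predP c :
  reflect (exists xi, autKGQ_class xi = c) (c \in outKGQ_pred).
Proof.
by apply: (iffP (asboolP _)) => [[xi _ <-]|[xi <-]]; [exists xi | exists xi].
Qed.

Fact outKGQ_1 : 1 \in outKGQ_pred.
Proof.
apply/outKGQ_predP; exists 1.
by apply: (@mulgI _ (autKGQ_class 1)); rewrite -gmulfM !mulg1.
Qed.

Fact outKGQ_M : mulg_closed outKGQ_pred.
Proof.
move=> _ _ /outKGQ_predP[x <-] /outKGQ_predP[y <-].
by apply/outKGQ_predP; exists (x * y); rewrite gmulfM.
Qed.

Fact outKGQ_V : invg_closed outKGQ_pred.
Proof.
move=> _ /outKGQ_predP[x <-]; apply/outKGQ_predP; exists x^-1.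
apply: (@mulgI _ (autKGQ_class x)); rewrite -gmulfM !mulgV.
by apply: (@mulgI _ (autKGQ_class 1)); rewrite -gmulfM !mulg1.
Qed.

Definition outKGQ_subgroup : subgroup outGK :=
  Subgroup (group_closedMV outKGQ_1 outKGQ_M outKGQ_V).

Definition outKGQ := sgroup outKGQ_subgroup.

HB.instance Definition _ := Group.on outKGQ.

End Extension.

(* Main.v *)
Require Import Defs.
From HB Require Import structures.
From mathcomp Require Import all_boot.
From mathcomp Require Import boolp classical_sets.

Set Implicit Arguments.
Unset Strict Implicit.
Unset Printing Implicit Defensive.

Local Open Scope group_scope.

(** Let g be in G.  An automorphism xi of G over Q moves g by an element
    xi(g) g^-1 of K.  If xi also fixes K pointwise, then conjugating K by xi(g)
    is the same as conjugating it by g, so that xi(g) g^-1 is central in K; and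
    replacing g by gk does not change it.  Hence xi(g) = l(pi g) g for a unique
    map l : Q -> Z(K) ([autKGQ_twist], [twist_inj]).  Conversely any map l
    defines a self-map [twist l] of G.  Since g acts on Z(K) by conjugation the
    way pi g acts through theta ([center_act_ext]), moving l(pi h) across g in
    the product (l(pi g) g)(l(pi h) h) shows that [twist l] is multiplicative
    exactly when l is a cocycle ([twist_morphP]).  This is the isomorphism from
    Z^1(Q,Z(K)) to Aut(KGQ).

    In Out(G;K) the automorphism [twist l] becomes trivial when it is
    conjugation by some k in K.  Such a k is central, because [twist l] fixes
    K, and k g k^-1 = k (g k g^-1)^-1 g says that l is the coboundary of k^-1;
    so the kernel of Z^1(Q,Z(K)) -> Out(KGQ;K) is B^1 ([star_fun_innerP]).  As
    this map is onto by the definition of Out(KGQ;K), the first isomorphism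
    theorem ([quot_ker_iso]) concludes. *)

Lemma inj_surj_bij (aT rT : Type) (f : aT -> rT) :
  injective f -> surjective f -> bijective f.
Proof.
move=> finj /choice[g fgK]; exists g => // x.
by apply: finj; rewrite fgK.
Qed.

(** The first isomorphism theorem: x and y have the same image under f exactly
    when x^-1 y lies in the kernel N, so f is well defined and injective on
    cosets. *)
Lemma quot_ker_iso (A B : groupType) (N : normal_subgroup A)
    (f : {multiplicative A -> B}) :
    (forall x, f x = 1 <-> x \in N) -> surjective f ->
  exists fbar : {multiplicative quot N -> B},
    (forall x, fbar (coset N x) = f x) /\ bijective fbar.
Proof.
move=> kerf fsurj.
have f_eq x y : f x = f y <-> coset N x = coset N y.
  rewrite (rwP (coset_eq N x y)) -kerf; split=> [fxy|].
    by apply: (@mulgI _ (f x)); rewrite -gmulfM mulg1 mulVKg fxy.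
  by move=> fxy1; rewrite -(mulVKg x y) gmulfM fxy1 mulg1.
pose fb (c : quot N) : B := f (coset_repr c).
have fbE x : fb (coset N x) = f x by apply/f_eq/coset_reprK.
have fbM : {morph fb : c d / c * d}.
  move=> c d; have [x <-] := coset_surj c; have [y <-] := coset_surj d.
  by rewrite -gmulfM !fbE gmulfM.
pose mm := isMultiplicative.Build _ _ fb fbM.
pose fbar : {multiplicative quot N -> B} := HB.pack fb mm.
exists fbar; split; first exact: fbE.
apply: inj_surj_bij => [c d|b].
  have [x <-] := coset_surj c; have [y <-] := coset_surj d.
  by rewrite /= !fbE => /f_eq.
by have [x <-] := fsurj b; exists (coset N x); apply: fbE.
Qed.

Section Twist.
Variables (K Q : groupType) (G : extension K Q).
Local Notation i := (ext_i G).
Local Notation pi := (ext_pi G).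
Local Notation ZK := (sgroup (center K)).

(** Defined for every map l, and not just for cocycles, so that an automorphism
    can be written in this form before its l is known to be a cocycle. *)
Definition twist (l : Q -> ZK) (g : G) : G := i (sgval (l (pi g))) * g.

Lemma twist_pi l g : pi (twist l g) = pi g.
Proof.
by rewrite [LHS]gmulfM (proj2 (ext_kerP _)) ?mul1g //; eexists.
Qed.

Lemma twist_inj l m : twist l =1 twist m -> l =1 m.
Proof.
move=> lm q; have [g <-] := ext_pi_surj G q.
by apply/val_inj/(@ext_i_inj _ _ G)/(@mulIg _ g)/lm.
Qed.

(** The displacement xi(g) g^-1 lies in K because xi is over Q, is central
    because xi is the identity on K, and depends on pi g alone because
    xi(gk) (gk)^-1 = xi(g) k k^-1 g^-1 for k in K. *)
Lemma autKGQ_twist (xi : autKGQ G) : exists l : Q -> ZK, sgval xi =1 twist l.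
Proof.
have /autKGQ_predP[xii xipi] := sgvalP xi.
move: (sgval xi) xii xipi => {xi} xi xii xipi.
have xiiE k : xi (i k) = i k by apply: xii.
have xipiE g : pi (xi g) = pi g by apply: xipi.
have central g : exists z : ZK, i (sgval z) = xi g * g^-1.
  have [k ik] : exists k, i k = xi g * g^-1.
    by apply/ext_kerP; rewrite gmulfM xipiE ext_piV mulgV.
  suff kZ : k \in center K by exists (SGroup kZ).
  apply/centerP => x; apply: (@ext_i_inj _ _ G); rewrite !gmulfM ik.
  (* x and its conjugate y by g^-1 are both fixed by xi, so x is the conjugate
     of y by g and also by xi g. *)
  have [y iy] := ext_normal g^-1 x; rewrite invgK in iy.
  have ixg : i x = g * i y * g^-1 by rewrite iy !mulgA mulgV mul1g mulgK.
  have ixxi : i x = xi g * i y * (xi g)^-1.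
    by rewrite -[LHS]xiiE ixg !autM aut_V xiiE.
  by rewrite [in LHS]ixg [in RHS]ixxi !mulgA !mulgVK.
have /choice[l lE] : forall q, exists z : ZK,
    forall g, pi g = q -> i (sgval z) = xi g * g^-1.
  move=> q; have [g <-] := ext_pi_surj G q; have [z zE] := central g.
  exists z => h hg.
  have [k kE] : exists k, i k = g^-1 * h.
    by apply/ext_kerP; rewrite gmulfM ext_piV hg mulVg.
  rewrite -(mulVKg g h) -kE autM xiiE invgM !mulgA mulgK.
  exact: zE.
by exists l => g; rewrite /twist (lE _ g) // mulgVK.
Qed.

End Twist.

Section CocycleTwist.
Variables (K Q : groupType) (theta : {multiplicative Q -> out K}).
Variables (G : extension K Q) (outerG : outer_action G =1 theta).
Local Notation i := (ext_i G).
Local Notation pi := (ext_pi G).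
Local Notation ZK := (sgroup (center K)).
Local Notation A := (center_module theta).

(** The action of Q on Z(K) is defined through theta; the hypothesis on the
    outer action of G makes it conjugation in G by any lift. *)
Lemma center_act_ext g (z : ZK) :
  i (sgval (center_act theta (pi g) z)) = g * i (sgval z) * g^-1.
Proof.
rewrite -restr_conjE; congr (i _); apply: center_actE.
by rewrite -outer_actionE outerG.
Qed.

(** Both sides say that the product of the twists of g and h, which is
    l(pi g) * (pi g . l(pi h)) * (g h), agrees with the twist of g h; as pi is
    onto, comparing the factors in Z(K) gives the cocycle identity on all of Q. *)
Lemma twist_morphP (l : Q -> ZK) :
  is_cocycle (l : Q -> A) <-> {morph twist l : g h / g * h :> G}.
Proof.
have twistM g h : twist l g * twist l h =
    i (sgval (l (pi g) * center_act theta (pi g) (l (pi h)))) * (g * h).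
  by rewrite valM gmulfM center_act_ext /twist !mulgA mulgVK.
split=> [[_ lM] g h|tM].
  by rewrite twistM /twist gmulfM lM.
have lM p q : l (p * q) = l p * center_act theta p (l q).
  have [g <-] := ext_pi_surj G p; have [h <-] := ext_pi_surj G q.
  apply/val_inj/(@ext_i_inj _ _ G)/(@mulIg _ (g * h)).
  by rewrite -gmulfM -twistM -tM.
(* Normalization follows from the cocycle identity at (1, 1). *)
split=> //; apply: (@mulgI _ (l 1)).
by rewrite -{2}[l 1](center_act1 theta) -lM !mulg1.
Qed.

(** A twist does not change the image in Q, so the second one uses the same
    value of its cocycle. *)
Lemma twistM (l m : Z1 A) g : twist (l * m) g = twist l (twist m g) :> G.
Proof. by rewrite /twist -/(twist m g) twist_pi valM gmulfM mulgA. Qed.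

Lemma twist1 g : twist (1 : Z1 A) g = g :> G.
Proof. by rewrite /twist ext_i1 mul1g. Qed.

Lemma twist_bij (l : Z1 A) : bijective (twist l : G -> G).
Proof.
by exists (twist l^-1) => g; rewrite -twistM (mulVg, mulgV) twist1.
Qed.

Definition twist_aut (l : Z1 A) : aut G :=
  mk_aut (twist_bij l) ((twist_morphP l).1 (cocycleP l)).

Lemma twist_autKGQ l : twist_aut l \in autKGQ_subgroup G.
Proof.
apply/autKGQ_predP; split=> [k|g]; last exact: twist_pi.
have [l1 _] := cocycleP l.
have pik : pi (i k) = 1 by apply/ext_kerP; exists k.
by rewrite /= /twist pik l1 ext_i1 mul1g.
Qed.

Definition star_fun (l : Z1 A) : autKGQ G := SGroup (twist_autKGQ l).

Lemma star_funM : {morph star_fun : l m / l * m}.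
Proof. by move=> l m; apply/val_inj/aut_eq => g; apply: twistM. Qed.

HB.instance Definition _ :=
  isMultiplicative.Build (Z1 A) (autKGQ G) star_fun star_funM.

Lemma star_fun_bij : bijective star_fun.
Proof.
apply: inj_surj_bij => [l m lm|xi].
  apply/cocycle_eq/(@twist_inj _ _ G) => g.
  by have := congr1 (fun xi : autKGQ G => sgval xi g) lm.
have [l xil] := autKGQ_twist xi.
have lZ : is_cocycle (l : Q -> A).
  by apply/twist_morphP => g h; rewrite -!xil autM.
exists (Cocycle (asboolT lZ)); apply/val_inj/aut_eq => g.
by rewrite xil.
Qed.

(** Conjugation by k multiplies g by k (g k g^-1)^-1, which is the value at
    pi g of the coboundary of a = k^-1 once k is known to be central: an inner
    automorphism by k that fixes K pointwise forces that. *)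
Lemma star_fun_innerP (l : Z1 A) :
  (exists k, sgval (star_fun l) = conj_aut (i k)) <-> l \in B1 A.
Proof.
split=> [[k lk]|/B1P[a la]].
  have lkE g : twist l g = i k * g * (i k)^-1.
    by rewrite -conj_autE -lk.
  have kZ : k \in center K.
    apply/centerP => x; apply: (@ext_i_inj _ _ G).
    have /autKGQ_predP[lK _] := twist_autKGQ l.
    have lx : twist l (i x) = i x by apply: lK.
    by rewrite !gmulfM -[in RHS]lx lkE mulgVK.
  apply/B1P; exists (SGroup kZ)^-1 => q; have [g <-] := ext_pi_surj G q.
  apply/val_inj/(@ext_i_inj _ _ G)/(@mulIg _ g).
  rewrite [LHS]lkE invgK valM gmulfM [hmact _ _]/= center_act_ext.
  by rewrite [sgval _]/= ext_iV !mulgA mulgVK.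
exists (sgval a)^-1; apply: aut_eq => g.
rewrite conj_autE /= /twist la valM gmulfM center_act_ext.
by rewrite ext_iV invgK !mulgA mulgVK -ext_iV.
Qed.

Definition star_class (l : Z1 A) : outKGQ G :=
  SGroup (S := outKGQ_subgroup G)
    (introT (outKGQ_predP _) (ex_intro _ (star_fun l) erefl)).

Lemma star_classM : {morph star_class : l m / l * m}.
Proof. by move=> l m; apply/val_inj; rewrite valM /= !gmulfM. Qed.

HB.instance Definition _ :=
  isMultiplicative.Build (Z1 A) (outKGQ G) star_class star_classM.

Lemma star_class_surj : surjective star_class.
Proof.
move=> c; have /outKGQ_predP[xi xic] := sgvalP c.
have [s _ sK] := star_fun_bij.
by exists (s xi); apply/val_inj; rewrite /= sK.
Qed.

Lemma star_class_ker l : star_class l = 1 <-> l \in B1 A.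
Proof.
rewrite -star_fun_innerP.
(* The identity of Out(KGQ;K) is the coset of 1 in Out(G;K), so that [coset_eq]
   applies. *)
have -> : star_class l = 1 <-> coset (innerK G) 1 = autKGQ_class (star_fun l).
  by split=> [l1|l1]; [rewrite -[RHS]/(sgval (star_class l)) l1 | apply/val_inj].
rewrite (rwP (coset_eq _ _ _)) invg1 mul1g.
by rewrite -(rwP (innerKP _)).
Qed.

End CocycleTwist.

Theorem corollary5p3 (K Q : groupType) (theta : {multiplicative Q -> out K})
    (G : extension K Q) (outerG : outer_action G =1 theta) :
  exists star : {multiplicative Z1 (center_module theta) -> autKGQ G},
    [/\ forall (l : Z1 (center_module theta)) (g : G),
          sgval (star l) g = ext_i G (sgval (l (ext_pi G g))) * g,
        bijective star
      & exists star_bar : {multiplicative H1 (center_module theta) -> outKGQ G},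
          (forall l : Z1 (center_module theta),
             sgval (star_bar (coset (B1 (center_module theta)) l))
               = autKGQ_class (star l))
          /\ bijective star_bar].
Proof.
exists (star_fun outerG); split=> //; first exact: star_fun_bij.
have [star_bar [barE bar_bij]] :=
  quot_ker_iso (star_class_ker outerG) (star_class_surj outerG).
by exists star_bar; split=> // l; rewrite barE.
Qed.
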